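(* Let $V$ be a finite set, let $K$ be a convex cone contained in $\{x\in\mathbb{R}^{\mathcal{P}_1(V)} \mid 0\le x_i\le x_{\mathbf 0}\ (i\in V)\}$, and let $t\ge 1$ be an integer. A vector $x\in\mathbb{R}^{\mathcal{P}_1(V)}$ lies in $N_+^t(K)$ if and only if there exist a matrix $Y\in\mathcal{M}_{+,V}$ and matrices $Y^{\sigma_1,\ldots,\sigma_s}_{i_1,\ldots,i_s}\in\mathcal{M}_{+,V}$, for $s=1,\ldots,t-1$, $i_1,\ldots,i_s\in V$ and $\sigma_1,\ldots,\sigma_s\in\{\pm1\}$, satisfying the following conditions: (a) $x=Ye_{\mathbf 0}$. (b) For all $s=1,\ldots,t-1$, $i_1,\ldots,i_s\in V$ and $\sigma_1,\ldots,\sigma_{s-1}\in\{\pm1\}$: $$Y^{\sigma_1,\ldots,\sigma_{s-1}}_{i_1,\ldots,i_{s-1}}e_{i_s}=Y^{\sigma_1,\ldots,\sigma_{s-1},+1}_{i_1,\ldots,i_s}e_{\mathbf 0},\qquad Y^{\sigma_1,\ldots,\sigma_{s-1}}_{i_1,\ldots,i_{s-1}}(e_{\mathbf 0}-e_{i_s})=Y^{\sigma_1,\ldots,\sigma_{s-1},-1}_{i_1,\ldots,i_s}e_{\mathbf 0},$$ where $Y^{\sigma_1,\ldots,\sigma_{s-1}}_{i_1,\ldots,i_{s-1}}$ means $Y$ when $s=1$. (c) For all $i_1,\ldots,i_t\in V$ and $\sigma_1,\ldots,\sigma_{t-1}\in\{\pm1\}$: $$Y^{\sigma_1,\ldots,\sigma_{t-1}}_{i_1,\ldots,i_{t-1}}e_{i_t}\in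 K,\qquad Y^{\sigma_1,\ldots,\sigma_{t-1}}_{i_1,\ldots,i_{t-1}}(e_{\mathbf 0}-e_{i_t})\in K,$$ where $Y^{\sigma_1,\ldots,\sigma_{t-1}}_{i_1,\ldots,i_{t-1}}$ means $Y$ when $t=1$.
   Context: For a finite set $V$, $\mathcal{P}_1(V)$ is the collection of subsets of $V$ of cardinality at most $1$; $\mathbf 0$ denotes the empty set and the singleton $\{i\}$ is identified with $i$. The standard unit vectors of $\mathbb{R}^{\mathcal{P}_1(V)}$ are $e_{\mathbf 0}$ and $e_i$ ($i\in V$). $Y\succeq0$ means that $Y$ is (symmetric) positive semidefinite. Convex cones contain the origin. Define $\mathcal{M}_{+,V}:=\{Y\in\mathbb{R}^{\mathcal{P}_1(V)\times\mathcal{P}_1(V)}\mid Y\succeq 0,\ Y_{ii}=Y_{\mathbf 0 i}\ (i\in V)\}$. For a convex cone $K\subseteq\mathbb{R}^{\mathcal{P}_1(V)}$ define $\mathcal{M}_+(K):=\{Y\in\mathcal{M}_{+,V}\mid Ye_i\in K,\ Y(e_{\mathbf 0}-e_i)\in K\ (i\in V)\}$ and $N_+(K):=\{Ye_{\mathbf 0}\mid Y\in\mathcal{M}_+(K)\}$. The iterates of the Lovász–Schrijver hierarchy are $N_+^0(K):=K$ and $N_+^t(K):=N_+(N_+^{t-1}(K))$ for $t\ge1$. *)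

(* Defs.v *)
From mathcomp Require Import all_boot all_order all_algebra.
From mathcomp Require Import classical_sets reals.
Set Implicit Arguments.
Unset Strict Implicit.
Unset Printing Implicit Defensive.
Import Order.TTheory GRing.Theory Num.Theory.
Local Open Scope classical_set_scope.
Local Open Scope ring_scope.

Definition P1 (V : finType) : finType := {A : {set V} | (#|A| <= 1)%N}.

Lemma card_set0_le1 (V : finType) : (#|@finset.set0 V| <= 1)%N.
Proof. by rewrite cards0. Qed.

Lemma card_set1_le1 (V : finType) (i : V) : (#|finset.set1 i| <= 1)%N.
Proof. by rewrite cards1. Qed.

Definition P1_empty (V : finType) : P1 V :=
  exist (fun A : {set V} => (#|A| <= 1)%N) _ (card_set0_le1 V).
Definition P1_single (V : finType) (i : V) : P1 V :=
  exist (fun A : {set V} => (#|A| <= 1)%N) _ (card_set1_le1 i).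

(* Vectors and matrices indexed by P1 V are library matrices, through the
   enumeration of P1 V. *)
Definition vec (R : realType) (V : finType) := 'cV[R]_#|P1 V|.
Definition mat (R : realType) (V : finType) := 'M[R]_#|P1 V|.

Definition idx0 (V : finType) : 'I_#|P1 V| := enum_rank (P1_empty V).
Definition idx (V : finType) (i : V) : 'I_#|P1 V| := enum_rank (P1_single i).

Definition e0 (R : realType) (V : finType) : vec R V := delta_mx (idx0 V) 0.
Definition e (R : realType) (V : finType) (i : V) : vec R V :=
  delta_mx (idx i) 0.
Arguments e0 {R V}.
Arguments e {R V} i.

Definition psd (R : realType) (n : nat) (Y : 'M[R]_n) : Prop :=
  Y^T = Y /\ forall u : 'cV[R]_n, 0 <= (u^T *m Y *m u) 0 0.

Definition convex_cone (R : realType) (n : nat) (K : set 'cV[R]_n) : Prop :=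
  [/\ K 0,
      forall x y, K x -> K y -> K (x + y)
    & forall (a : R) x, 0 <= a -> K x -> K (a *: x)].

Definition MplusV (R : realType) (V : finType) : set (mat R V) :=
  [set Y | psd Y /\ forall i : V, Y (idx i) (idx i) = Y (idx0 V) (idx i)].

Definition Mplus (R : realType) (V : finType) (K : set (vec R V)) :
    set (mat R V) :=
  [set Y | MplusV Y /\
    forall i : V, K (Y *m e i) /\ K (Y *m (e0 - e i))].

Definition Nplus (R : realType) (V : finType) (K : set (vec R V)) :
    set (vec R V) :=
  [set Y *m e0 | Y in Mplus K].

Definition Nplus_iter (R : realType) (V : finType) (t : nat)
    (K : set (vec R V)) : set (vec R V) :=
  iter t (@Nplus R V) K.

(* F s (i_1, ..., i_s) (sigma_1, ..., sigma_s) is the matrix with these lower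
   and upper indices; a sign is a boolean, true for +1 and false for -1. *)
Definition mat_family (R : realType) (V : finType) :=
  forall s : nat, s.-tuple V -> s.-tuple bool -> mat R V.

(* The family F with the matrix of the empty index sequence taken to be Y;
   the value of F at length 0 is never used. *)
Definition rooted (R : realType) (V : finType) (Y : mat R V)
    (F : mat_family R V) : mat_family R V :=
  fun s => if s is 0%N then fun _ _ => Y else F s.
Arguments rooted {R V} Y F s i sigma.

(* Main.v *)
Require Import Defs.
From mathcomp Require Import all_boot all_order all_algebra.
From mathcomp Require Import classical_sets reals.
Import Order.TTheory GRing.Theory Num.Theory.
Local Open Scope classical_set_scope.
Local Open Scope ring_scope.

(** Membership in [Nplus_iter t K] unfolds into a tree.  A vector of
    N_+(N_+^n(K)) has a witness matrix [Y] whose columns [Y *m e i] and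
    differences [Y *m (e0 - e i)] lie in N_+^n(K); when n is positive each of
    these vectors has a witness of its own, one level down, and after t levels
    the vectors lie in [K].  The matrix with indices i_1, ..., i_s and signs
    sigma_1, ..., sigma_s is the node of this tree reached by the successive
    branches (i_1, sigma_1), ..., (i_s, sigma_s); condition (b) says that it
    is a witness for the vector attached to its incoming edge.

    From left to right, a choice of witnesses ([witness]) is iterated along
    branches ([branch_witness]), and a node at depth s belongs to
    M_+(N_+^(t-1-s)(K)) ([branch_witnessP]).  From right to left, the same
    memberships are recovered from the leaves, where they are condition (c),
    up to the root ([rooted_Mplus]). *)

(** The edge labelled [d] leaving a node that carries [Y] is attached the
    vector [Y *m edge d]; [d.2] encodes the sign. *)
Definition edge {R : realType} {V : finType} (d : V * bool) : vec R V :=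
  if d.2 then e d.1 else e0 - e d.1.

Lemma Mplus_edge {R : realType} {V : finType} (K : set (vec R V)) (Y : mat R V)
    (d : V * bool) :
  Mplus K Y -> K (Y *m edge d).
Proof. by case: d => i [] [_ /(_ i)[]]. Qed.

Definition witness {R : realType} {V : finType} (K : set (vec R V))
    (x : vec R V) : mat R V :=
  xget 0 [set Y | Mplus K Y /\ Y *m e0 = x].

Lemma witnessP {R : realType} {V : finType} (K : set (vec R V)) (x : vec R V) :
  Nplus K x -> Mplus K (witness K x) /\ witness K x *m e0 = x.
Proof.
case=> Y KY Yx.
exact: (@xgetPex _ 0 [set Z | _ /\ _] (ex_intro _ Y (conj KY Yx))).
Qed.

(** Branches are listed from the deepest edge up to the root, so that
    extending an index sequence at its end, as in condition (b), is one
    unfolding of the recursion.  With [Y] in M_+(N_+^n(K)) at the root, the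
    vector on an edge into a node at depth s >= 1 lies in N_+^(n-s+1)(K), so the node
    carries a witness taken from M_+(N_+^(n-s)(K)). *)
Fixpoint branch_witness {R : realType} {V : finType} (K : set (vec R V))
    (n : nat) (Y : mat R V) (p : seq (V * bool)) : mat R V :=
  if p is d :: q then
    witness (Nplus_iter (n - size p) K)
      (branch_witness K n Y q *m edge d)
  else Y.

Lemma branch_witnessP {R : realType} {V : finType} (K : set (vec R V))
    (n : nat) (Y : mat R V) (p : seq (V * bool)) :
  Mplus (Nplus_iter n K) Y -> (size p <= n)%N ->
  Mplus (Nplus_iter (n - size p) K) (branch_witness K n Y p).
Proof.
move=> KY; elim: p => [|d q IHq] lt_q_n; first by rewrite subn0.
have := Mplus_edge _ _ d (IHq (ltnW lt_q_n)).
by rewrite /= -(subnSK lt_q_n) => /witnessP[].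
Qed.

Lemma branch_witness_edge {R : realType} {V : finType} (K : set (vec R V))
    (n : nat) (Y : mat R V) (d : V * bool) (q : seq (V * bool)) :
  Mplus (Nplus_iter n K) Y -> (size q < n)%N ->
  branch_witness K n Y q *m edge d = branch_witness K n Y (d :: q) *m e0.
Proof.
move=> KY lt_q_n.
have := Mplus_edge _ _ d (branch_witnessP _ _ _ _ KY (ltnW lt_q_n)).
by rewrite /= -(subnSK lt_q_n) => /witnessP[].
Qed.

(** Induction on the height [k] of a node above the leaves: condition (c) is
    the case of the leaves, and above them condition (b) exhibits each child
    as a witness for the vector on the edge leading to it. *)
Lemma rooted_Mplus {R : realType} {V : finType} (K : set (vec R V)) (n : nat)
    (Y : mat R V) (F : mat_family R V) :
  (forall s (i : s.-tuple V) (sigma : s.-tuple bool), (s <= n)%N ->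
     MplusV (rooted Y F s i sigma)) ->
  (forall r, (r < n)%N ->
     forall (i : r.-tuple V) (j : V) (sigma : r.-tuple bool),
       rooted Y F r i sigma *m e j
         = F r.+1 (rcons_tuple i j) (rcons_tuple sigma true) *m e0 /\
       rooted Y F r i sigma *m (e0 - e j)
         = F r.+1 (rcons_tuple i j) (rcons_tuple sigma false) *m e0) ->
  (forall (i : n.-tuple V) (j : V) (sigma : n.-tuple bool),
     K (rooted Y F n i sigma *m e j) /\
     K (rooted Y F n i sigma *m (e0 - e j))) ->
  forall k r (i : r.-tuple V) (sigma : r.-tuple bool), (r + k = n)%N ->
    Mplus (Nplus_iter k K) (rooted Y F r i sigma).
Proof.
move=> FM Fb Fc; elim=> [|k IHk] r i sigma.
  by rewrite addn0 => rn; subst r; split=> [|j]; [exact: FM | exact: Fc].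
rewrite addnS -addSn => rk_n.
have lt_r_n : (r < n)%N by rewrite -rk_n leq_addr.
split=> [|j]; first exact/FM/ltnW.
have [-> ->] := Fb r lt_r_n i j sigma.
by split; [exists (F r.+1 (rcons_tuple i j) (rcons_tuple sigma true))
  | exists (F r.+1 (rcons_tuple i j) (rcons_tuple sigma false))] => //;
  exact: (IHk r.+1).
Qed.

Theorem proposition2p1 (R : realType) (V : finType) (K : set (vec R V))
    (hK : convex_cone K)
    (hKbox : K `<=` [set x : vec R V |
                      forall i : V, 0 <= x (idx i) 0 <= x (idx0 V) 0])
    (t : nat) (ht : (1 <= t)%N) (x : vec R V) :
  Nplus_iter t K x <->
  exists (Y : mat R V) (F : mat_family R V),
    MplusV Y /\
    (forall s : nat, (1 <= s <= t.-1)%N ->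
       forall (i : s.-tuple V) (sigma : s.-tuple bool),
         MplusV (F s i sigma)) /\
    (* (a) *)
    x = Y *m e0 /\
    (* (b), with r = s - 1 and j = i_s *)
    (forall r : nat, (r.+1 <= t.-1)%N ->
       forall (i : r.-tuple V) (j : V) (sigma : r.-tuple bool),
         rooted Y F r i sigma *m e j
           = F r.+1 (rcons_tuple i j) (rcons_tuple sigma true) *m e0 /\
         rooted Y F r i sigma *m (e0 - e j)
           = F r.+1 (rcons_tuple i j) (rcons_tuple sigma false) *m e0) /\
    (* (c), with j = i_t *)
    (forall (i : t.-1.-tuple V) (j : V) (sigma : t.-1.-tuple bool),
       K (rooted Y F t.-1 i sigma *m e j) /\
       K (rooted Y F t.-1 i sigma *m (e0 - e j))).
Proof.
case: t ht => // n _; rewrite [n.+1.-1]/=; split.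
  case=> Y KY <-.
  pose G s (i : s.-tuple V) (sigma : s.-tuple bool) :=
    branch_witness K n Y (rev (zip i sigma)).
  have size_branch s (i : s.-tuple V) (sigma : s.-tuple bool) :
    size (rev (zip i sigma)) = s.
    by rewrite size_rev size_zip !size_tuple minnn.
  have rootedG s i sigma : rooted Y G s i sigma = G s i sigma.
    by case: s i sigma => [|s] i sigma //; rewrite /G (tuple0 i) (tuple0 sigma).
  have GP s (i : s.-tuple V) (sigma : s.-tuple bool) : (s <= n)%N ->
    Mplus (Nplus_iter (n - s) K) (G s i sigma).
    move=> le_s_n.
    have := branch_witnessP K n Y (rev (zip i sigma)) KY.
    by rewrite size_branch; apply.
  have GE r (i : r.-tuple V) j (sigma : r.-tuple bool) b : (r < n)%N ->
    G r i sigma *m edge (j, b)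
      = G r.+1 (rcons_tuple i j) (rcons_tuple sigma b) *m e0.
    move=> lt_r_n; rewrite /G /= zip_rcons ?size_tuple // rev_rcons.
    by apply: branch_witness_edge; rewrite ?size_branch.
  exists Y, G; split; first by case: KY.
  split; first by move=> s /andP[_ le_s_n] i sigma; case: (GP s i sigma le_s_n).
  split=> //; split=> [r lt_r_n i j sigma | i j sigma].
    by rewrite rootedG; split; [exact: (GE _ _ _ _ true)
                               | exact: (GE _ _ _ _ false)].
  by rewrite rootedG; have [_] := GP n i sigma (leqnn n); rewrite subnn; apply.
case=> Y [F [YM [FM [-> [Fb Fc]]]]].
have rooted_MplusV s (i : s.-tuple V) (sigma : s.-tuple bool) :
  (s <= n)%N -> MplusV (rooted Y F s i sigma).
  by case: s i sigma => [|s] i sigma le_s_n //; apply: FM.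
exists Y => //.
exact: (rooted_Mplus _ _ _ _ rooted_MplusV Fb Fc n 0%N [tuple] [tuple]).
Qed.
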